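(* Let $A \in M_{n\times m}(\mathbb{T})$, let $H = H_A$ be its $\mathcal{H}$-class in $M(\mathbb{T})$, and let $\mathrm{Aut}(C(A))$ denote the group of $\mathbb{T}$-semimodule automorphisms of the column space $C(A)$. Then: (i) for each $f \in \mathrm{Aut}(C(A))$ there exists $F \in M_n(\mathbb{T})$ such that $\phi_F \in \Gamma_H$ and $\phi_F$ maps $A$ to the matrix obtained by applying $f$ to each column of $A$; and (ii) the map $\psi\colon \mathrm{Aut}(C(A)) \to \Gamma_H$, $f \mapsto \phi_F$ (with $F$ as in (i)), is a group isomorphism, with inverse $\varphi\colon \Gamma_H \to \mathrm{Aut}(C(A))$, $\phi_X \mapsto (x \mapsto X\otimes x)$.
   Context: $\mathbb{T} = \mathbb{R}\cup\{-\infty\}$ is the tropical semiring, with $\oplus = \max$ and $\otimes = +$. $\mathbb{N}$ is the set of positive integers. $M(\mathbb{T})$ is the category of all matrices of any size $n\times m$ ($n,m\in\mathbb{N}$) over $\mathbb{T}$, with tropical matrix multiplication whenever sizes are compatible; $M_{n\times m}(\mathbb{T})$ is the set of $n\times m$ matrices and $M_n(\mathbb{T})=M_{n\times n}(\mathbb{T})$. Matrices act on column vectors by tropical multiplication. $\mathbb{T}^n$ is a $\mathbb{T}$-semimodule under componentwise $\oplus$ and tropical scaling. The column space $C(A)\subseteq\mathbb{T}^n$ of $A\in M_{n\times m}(\mathbb{T})$ is the subsemimodule generated by the columns of $A$. Write $S=M(\mathbb{T})$. For $a,b\in S$: $a\mathrel{\mathcal{R}}b$ if $aS=bS$, $a\mathrel{\mathcal{L}}b$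 if $Sa=Sb$ (all products that are defined), and $a\mathrel{\mathcal{H}}b$ if both hold. $H_a$ is the $\mathcal{H}$-class of $a$. For an $\mathcal{H}$-class $H$ and $s\in S$ such that $sh$ is defined for all $h\in H$ and $sH\subseteq H$, let $\phi_s\colon H\to H$, $a\mapsto sa$. The (left) Schützenberger group of $H$ is $\Gamma_H=\{\phi_s : s\in S,\ sH\subseteq H\}$, a group under composition. *)

(* Defs.v *)
From HB Require Import structures.
From mathcomp Require Import all_boot all_order all_algebra.
From mathcomp Require Import all_classical all_reals.

Set Implicit Arguments.
Unset Strict Implicit.
Unset Printing Implicit Defensive.

Import Order.TTheory GRing.Theory Num.Theory.

Local Open Scope classical_set_scope.
Local Open Scope ring_scope.

(* The tropical semiring: [None] is -oo. Its ring-scope [+] is the maximum,   *)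
(* its [*] is the addition of R, its [0] is -oo and its [1] is 0%R.           *)
Definition tropical (R : realType) : Type := option R.

Section Tropical.
Variable R : realType.
Local Notation T := (tropical R).

Definition trop_add (x y : T) : T :=
  match x, y with
  | Some a, Some b => Some (Num.max a b)
  | Some _, None => x
  | None, _ => y
  end.

Definition trop_mul (x y : T) : T :=
  match x, y with
  | Some a, Some b => Some (a + b)
  | _, _ => None
  end.

Fact trop_addA : associative trop_add.
Proof. by move=> [a|] [b|] [c|] //=; rewrite maxA. Qed.

Fact trop_addC : commutative trop_add.
Proof. by move=> [a|] [b|] //=; rewrite maxC. Qed.

Fact trop_add0 : left_id None trop_add.
Proof. by case. Qed.

Fact trop_mulA : associative trop_mul.
Proof. by move=> [a|] [b|] [c|] //=; rewrite addrA. Qed.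

Fact trop_mulC : commutative trop_mul.
Proof. by move=> [a|] [b|] //=; rewrite addrC. Qed.

Fact trop_mul1 : left_id (Some 0) trop_mul.
Proof. by case=> //= a; rewrite add0r. Qed.

Fact trop_mulDl : left_distributive trop_mul trop_add.
Proof. by move=> [a|] [b|] [c|] //=; rewrite addr_maxl. Qed.

Fact trop_mul0 : left_zero None trop_mul.
Proof. by case. Qed.

Fact trop_oner_neq0 : (Some 0 : option R) != None.
Proof. by []. Qed.

HB.instance Definition _ := Choice.on T.
HB.instance Definition _ :=
  GRing.isNmodule.Build T trop_addA trop_addC trop_add0.
HB.instance Definition _ := GRing.Nmodule_isComNzSemiRing.Build T
  trop_mulA trop_mulC trop_mul1 trop_mulDl trop_mul0 trop_oner_neq0.

End Tropical.

Section SemimoduleAut.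
Variables (K : pzSemiRingType) (V : lSemiModType K).

(* {linear V -> V} only asks for compatibility with +, 0 and *:, which makes  *)
(* sense for semimodules.                                                     *)
Record semimod_aut : Type := SemimodAut {
  aut_lin :> {linear V -> V};
  aut_bij : bijective aut_lin }.

HB.instance Definition _ := gen_eqMixin semimod_aut.
HB.instance Definition _ := gen_choiceMixin semimod_aut.

Lemma semimod_autP (f g : semimod_aut) : f =1 g -> f = g.
Proof.
case: f g => [[f [[f1] [f2]]] bf] [[g [[g1] [g2]]] bg] /= /funext fg.
rewrite /= in fg; case: _ / fg in g1 g2 bg *.
by rewrite (Prop_irrelevance f1 g1) (Prop_irrelevance f2 g2)
           (Prop_irrelevance bf bg).
Qed.

Definition semimod_aut1 : semimod_aut :=
  @SemimodAut idfun (Bijective (frefl _) (frefl _)).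

Definition semimod_autM (f g : semimod_aut) : semimod_aut :=
  @SemimodAut (f \o g) (bij_comp (aut_bij f) (aut_bij g)).

Fact semimod_autV_subproof (f : semimod_aut) :
  exists g : semimod_aut, cancel f g /\ cancel g f.
Proof.
have [g fK gK] := aut_bij f.
have gL : semilinear g.
  by split=> [a x|x y]; apply: (canLR fK); rewrite ?linearZZ ?raddfD /= !gK.
pose g_lin := GRing.isSemilinear.Build _ _ _ _ g gL.
pose G : {linear V -> V} := HB.pack g g_lin.
by exists (@SemimodAut G (Bijective gK fK)).
Qed.

Definition semimod_autV (f : semimod_aut) : semimod_aut :=
  sval (cid (semimod_autV_subproof f)).

Fact semimod_autMA : associative semimod_autM.
Proof. by move=> f g h; apply: semimod_autP. Qed.
Fact semimod_aut1M : left_id semimod_aut1 semimod_autM.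
Proof. by move=> f; apply: semimod_autP. Qed.
Fact semimod_autM1 : right_id semimod_aut1 semimod_autM.
Proof. by move=> f; apply: semimod_autP. Qed.
Fact semimod_autVM : left_inverse semimod_aut1 semimod_autV semimod_autM.
Proof.
move=> f; apply: semimod_autP => x /=.
by rewrite /semimod_autV; case: cid => g [/= fK _]; rewrite fK.
Qed.
Fact semimod_autMV : right_inverse semimod_aut1 semimod_autV semimod_autM.
Proof.
move=> f; apply: semimod_autP => x /=.
by rewrite /semimod_autV; case: cid => g [/= _ gK]; rewrite gK.
Qed.

HB.instance Definition _ := isGroup.Build semimod_aut
  semimod_autMA semimod_aut1M semimod_autM1 semimod_autVM semimod_autMV.

End SemimoduleAut.

Section ColumnSpace.
Variables (R : realType) (n m : nat).
Local Notation T := (tropical R).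
Variable A : 'M[T]_(n, m).

(* The smallest subsemimodule containing the columns of A.                    *)
Definition col_span : {pred 'cV[T]_n} := fun x =>
  `[< forall P : {pred 'cV[T]_n}, GRing.subsemimod_closed P ->
      (forall j, col j A \in P) -> x \in P >].

Fact col_span_closed : GRing.subsemimod_closed col_span.
Proof.
split; first split.
- by apply/asboolP => P [[]].
- move=> x y /asboolP Px /asboolP Py; apply/asboolP => P Pc PA.
  by apply: Pc.1.2; [apply: Px | apply: Py].
- move=> a x /asboolP Px; apply/asboolP => P Pc PA.
  by apply: Pc.2; apply: Px.
Qed.

Fact col_in_span j : col j A \in col_span.
Proof. by apply/asboolP => P _; apply. Qed.

Lemma col_spanP x :
  reflect (exists c : 'I_m -> T, x = \sum_j c j *: col j A) (x \in col_span).
Proof.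
apply: (iffP idP) => [/asboolP Px|[c ->]]; last first.
  apply/asboolP => P [[P0 PD] PZ] PA.
  by apply: (big_ind (fun y => y \in P)) => // j _; apply: PZ; apply: PA.
pose P : {pred 'cV[T]_n} := fun y =>
  `[< exists c : 'I_m -> T, y = \sum_j c j *: col j A >].
suff /asboolP : x \in P by [].
apply: Px => [|j]; first split; first split.
- apply/asboolP; exists (fun=> 0).
  by rewrite big1 // => j _; rewrite scale0r.
- move=> _ _ /asboolP[c ->] /asboolP[d ->]; apply/asboolP.
  exists (fun j => c j + d j); rewrite -big_split /=.
  by apply: eq_bigr => j _; rewrite scalerDl.
- move=> a _ /asboolP[c ->]; apply/asboolP; exists (fun j => a * c j).
  by rewrite scaler_sumr; apply: eq_bigr => j _; rewrite scalerA.
- apply/asboolP; exists (fun k => if k == j then 1 else 0).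
  rewrite (bigD1 j) //= eqxx scale1r big1 ?addr0 // => k /negbTE ->.
  by rewrite scale0r.
Qed.

Record colspace : Type := ColSpace {
  col_vec :> 'cV[T]_n;
  col_vecP : col_vec \in col_span }.

HB.instance Definition _ := [isSub for col_vec].
HB.instance Definition _ := [Choice of colspace by <:].
HB.instance Definition _ :=
  GRing.SubChoice_isSubLSemiModule.Build T 'cV[T]_n col_span colspace
    col_span_closed.

Definition col_gen (j : 'I_m) : colspace := ColSpace (col_in_span j).

Definition map_cols (f : colspace -> colspace) : 'M[T]_(n, m) :=
  \matrix_(i, j) (f (col_gen j) : 'cV_n) i 0.

End ColumnSpace.

Section MatrixCategory.
Variable R : realType.
Local Notation T := (tropical R).

(* Sizes range over positive integers, hence the successors.                  *)
Record tmat : Type := TMat {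
  nrow : nat;
  ncol : nat;
  tmat_mx : 'M[T]_(nrow.+1, ncol.+1) }.

(* [conform_mx] is only a cast here: in the branch where it is used, the two  *)
(* sizes agree.                                                               *)
Definition tmul (a b : tmat) : option tmat :=
  if ncol a == nrow b
  then Some (TMat (tmat_mx a *m
                   conform_mx (0 : 'M_((ncol a).+1, (ncol b).+1)) (tmat_mx b)))
  else None.

Lemma tmulE n p m (X : 'M[T]_(n.+1, p.+1)) (Y : 'M[T]_(p.+1, m.+1)) :
  tmul (TMat X) (TMat Y) = Some (TMat (X *m Y)).
Proof. by rewrite /tmul /= eqxx conform_mx_id. Qed.

Lemma tmulA a b c : obind (tmul^~ c) (tmul a b) = obind (tmul a) (tmul b c).
Proof.
case: a b c => [n p X] [p' q Y] [q' r Z].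
have [ep|np] := eqVneq p p'; last first.
  rewrite /tmul /= (negbTE np) /=; case: ifP => //= _.
  by rewrite (negbTE np).
subst p'; rewrite tmulE /=.
have [eq|nq] := eqVneq q q'; last by rewrite /tmul /= (negbTE nq).
by subst q'; rewrite !tmulE /= !tmulE mulmxA.
Qed.

Lemma tmulA_Some a b c ab abc : tmul a b = Some ab -> tmul ab c = Some abc ->
  exists2 bc, tmul b c = Some bc & tmul a bc = Some abc.
Proof.
move=> eab eabc; have := tmulA a b c; rewrite eab /= eabc.
by case: (tmul b c) => //= bc ebc; exists bc.
Qed.

Lemma tmulSome_A a b c bc abc : tmul b c = Some bc -> tmul a bc = Some abc ->
  exists2 ab, tmul a b = Some ab & tmul ab c = Some abc.
Proof.
move=> ebc eabc; have := tmulA a b c; rewrite ebc /= eabc.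
by case: (tmul a b) => //= ab eab; exists ab.
Qed.

Definition tid (n : nat) : tmat := TMat (1%:M : 'M[T]_n.+1).

Lemma tmul1 a : tmul a (tid (ncol a)) = Some a.
Proof. by case: a => n p X; rewrite tmulE mulmx1. Qed.

Lemma tmul_tid a : tmul (tid (nrow a)) a = Some a.
Proof. by case: a => n p X; rewrite tmulE mul1mx. Qed.

Definition right_ideal (a : tmat) : set tmat :=
  [set c | exists x, tmul a x = Some c].
Definition left_ideal (a : tmat) : set tmat :=
  [set c | exists x, tmul x a = Some c].

Definition greenR (a b : tmat) : Prop := right_ideal a = right_ideal b.
Definition greenL (a b : tmat) : Prop := left_ideal a = left_ideal b.
Definition greenH (a b : tmat) : Prop := greenR a b /\ greenL a b.

Definition Hclass (a : tmat) : set tmat := [set b | greenH a b].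

Lemma right_ideal_self a : right_ideal a a.
Proof. by exists (tid (ncol a)); rewrite tmul1. Qed.

Lemma left_ideal_self a : left_ideal a a.
Proof. by exists (tid (nrow a)); rewrite tmul_tid. Qed.

Lemma right_ideal_sub a b : right_ideal a b -> right_ideal b `<=` right_ideal a.
Proof.
move=> [x ax] c [y by_]; have [z _ az] := tmulA_Some ax by_.
by exists z.
Qed.

Lemma left_ideal_sub a b : left_ideal a b -> left_ideal b `<=` left_ideal a.
Proof.
move=> [x xa] c [y yb]; have [z _ za] := tmulSome_A xa yb.
by exists z.
Qed.

Lemma greenR_mul s a b c d : greenR a b ->
  tmul s a = Some c -> tmul s b = Some d -> greenR c d.
Proof.
have main a' b' c' d' : greenR a' b' -> tmul s a' = Some c' ->
    tmul s b' = Some d' -> right_ideal c' d'.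
  move=> ab sa sb; have [x ax] : right_ideal a' b'.
    by rewrite ab; apply: right_ideal_self.
  by have [y sa' yx] := tmulSome_A ax sb; exists x; move: sa' yx; rewrite sa => -[<-].
move=> ab sa sb; apply/seteqP; split; apply: right_ideal_sub.
  exact: main (esym ab) sb sa.
exact: main ab sa sb.
Qed.

Lemma Hclass_refl a : Hclass a a.
Proof. by []. Qed.

Section Schutzenberger.
Variable a : tmat.

Definition Htype : Type := {h : tmat | Hclass a h}.

Definition Hself : Htype := exist _ a (Hclass_refl a).

(* s h is defined and lies in H, for every h in H = H_a.                      *)
Definition stabilizes (s : tmat) : Prop :=
  forall h, Hclass a h -> exists2 c, tmul s h = Some c & Hclass a c.

Fact phi_subproof s (hs : stabilizes s) (h : Htype) :
  Hclass a (odflt (sval h) (tmul s (sval h))).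
Proof. by case: (hs _ (svalP h)) => c ->. Qed.

(* The default of [odflt] is never used, see [phiE].                          *)
Definition phi s (hs : stabilizes s) : Htype -> Htype :=
  fun h => exist _ (odflt (sval h) (tmul s (sval h))) (phi_subproof hs h).

Lemma phiE s (hs : stabilizes s) h :
  tmul s (sval h) = Some (sval (phi hs h)).
Proof. by rewrite /=; case: (hs _ (svalP h)) => c ->. Qed.

Record schutzenberger : Type := Schutzenberger {
  schutz_fun :> Htype -> Htype;
  schutzP : exists s (hs : stabilizes s), schutz_fun = phi hs }.

Definition phiG s (hs : stabilizes s) : schutzenberger :=
  @Schutzenberger (phi hs) (ex_intro _ s (ex_intro _ hs erefl)).

HB.instance Definition _ := gen_eqMixin schutzenberger.
HB.instance Definition _ := gen_choiceMixin schutzenberger.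

Lemma schutz_eqP (f g : schutzenberger) : f =1 g -> f = g.
Proof.
case: f g => [f bf] [g bg] /= /funext fg.
by case: _ / fg in bg *; rewrite (Prop_irrelevance bf bg).
Qed.

Lemma tmul_phi s (hs : stabilizes s) h c :
  tmul s (sval h) = Some c -> sval (phi hs h) = c.
Proof. by rewrite phiE => -[]. Qed.

Lemma sval_Htype_inj (g h : Htype) : sval g = sval h -> g = h.
Proof. by case: g h => [g Hg] [h Hh] /= e; apply: eq_exist. Qed.

Lemma Htype_right (b : tmat) (h : Htype) :
  Hclass a b -> exists x, tmul b x = Some (sval h).
Proof.
move=> [Rab _]; have [Rah _] := svalP h.
suff : right_ideal b (sval h) by [].
by rewrite -Rab Rah; apply: right_ideal_self.
Qed.

Fact schutz1_subproof : exists s (hs : stabilizes s), id = phi hs.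
Proof.
have idE (h : Htype) : tmul (tid (nrow a)) (sval h) = Some (sval h).
  have [x ax] := Htype_right h (Hclass_refl a).
  by have [y] := tmulA_Some (tmul_tid a) ax; rewrite ax => -[<-].
have hs : stabilizes (tid (nrow a)).
  by move=> h Hh; exists h => //; apply: (idE (exist _ h Hh)).
exists _, hs; apply/funext => h; apply: sval_Htype_inj.
by rewrite (tmul_phi hs (idE h)).
Qed.

Fact schutzM_subproof (f g : schutzenberger) :
  exists s (hs : stabilizes s), f \o g = phi hs.
Proof.
have [s [hs ->]] := schutzP f; have [t [ht ->]] := schutzP g.
have [u eu uE] := tmulSome_A (phiE ht Hself) (phiE hs (phi ht Hself)).
have phiuE h : tmul u (sval h) = Some (sval (phi hs (phi ht h))).
  have [v ev] := tmulSome_A (phiE ht h) (phiE hs (phi ht h)).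
  by move: ev; rewrite eu => -[->].
have hu : stabilizes u.
  move=> h Hh; exists (sval (phi hs (phi ht (exist _ h Hh)))).
    by rewrite -(phiuE (exist _ h Hh)).
  exact: svalP.
exists u, hu; apply/funext => h; apply: sval_Htype_inj.
by rewrite (tmul_phi hu (phiuE h)).
Qed.

Fact schutzV_subproof (f : schutzenberger) :
  exists g : schutzenberger, cancel f g /\ cancel g f.
Proof.
have [s [hs ->]] := schutzP f.
set b := phi hs Hself; have sa : tmul s a = Some (sval b) := phiE hs Hself.
have [t tb] : left_ideal (sval b) a.
  by have [_ <-] := svalP b; apply: left_ideal_self.
have tsK h c : Hclass a h -> tmul s h = Some c -> tmul t c = Some h.
  move=> Hh sh; have [x ax] := Htype_right (exist _ h Hh) (Hclass_refl a).
  have [y sax yE] := tmulSome_A ax sh.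
  move: sax yE; rewrite sa => -[<-] bx.
  have [z bx' tz] := tmulA_Some tb ax.
  by move: bx' tz; rewrite bx => -[<-].
have stE (h : Htype) :
    exists k, [/\ tmul t (sval h) = Some k, tmul s k = Some (sval h)
               & Hclass a k].
  have [x bx] := Htype_right h (svalP b).
  have [k tk ak] : exists2 k, tmul a x = Some k & tmul t (sval h) = Some k.
    have := tmulA t (sval b) x; rewrite tb bx /=.
    case ax: (tmul a x) => [k|] => [<-|]; first by exists k.
    move: ax bx; have := tmulA s a x; rewrite sa /= => -> -> //.
  have sk : tmul s k = Some (sval h).
    by have [z] := tmulA_Some sa bx; rewrite tk => -[<-].
  exists k; split=> //; split.
    have [Rab _] := svalP b; have [Rah _] := svalP h.
    by apply: greenR_mul tb ak; rewrite /greenR -Rab.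
  have [_ Lah] := svalP h; rewrite /greenL Lah.
  by apply/seteqP; split; apply: left_ideal_sub; [exists s | exists t].
have ht : stabilizes t.
  by move=> h Hh; have [k [tk _ Hk]] := stE (exist _ h Hh); exists k.
exists (phiG ht); split=> h; apply: sval_Htype_inj; apply: tmul_phi.
  by apply: tsK (svalP h) _; apply: phiE.
have [k [tk sk _]] := stE h.
by rewrite (tmul_phi ht tk).
Qed.

Definition schutz1 : schutzenberger := Schutzenberger schutz1_subproof.
Definition schutzM (f g : schutzenberger) : schutzenberger :=
  Schutzenberger (schutzM_subproof f g).
Definition schutzV (f : schutzenberger) : schutzenberger :=
  sval (cid (schutzV_subproof f)).

Fact schutzMA : associative schutzM.
Proof. by move=> f g h; apply: schutz_eqP. Qed.
Fact schutz1M : left_id schutz1 schutzM.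
Proof. by move=> f; apply: schutz_eqP. Qed.
Fact schutzM1 : right_id schutz1 schutzM.
Proof. by move=> f; apply: schutz_eqP. Qed.
Fact schutzVM : left_inverse schutz1 schutzV schutzM.
Proof.
move=> f; apply: schutz_eqP => x; rewrite /schutzM /schutzV /=.
by case: cid => g [/= fK _]; rewrite fK.
Qed.
Fact schutzMV : right_inverse schutz1 schutzV schutzM.
Proof.
move=> f; apply: schutz_eqP => x; rewrite /schutzM /schutzV /=.
by case: cid => g [/= _ gK]; rewrite gK.
Qed.

HB.instance Definition _ := isGroup.Build schutzenberger
  schutzMA schutz1M schutzM1 schutzVM schutzMV.

End Schutzenberger.
End MatrixCategory.

Arguments Hself {R} a.
Arguments schutzenberger {R} a.
Arguments stabilizes {R} a s.

(* Main.v *)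
From HB Require Import structures.
Require Import Defs.
From mathcomp Require Import all_boot all_order all_algebra.
From mathcomp Require Import all_classical all_reals.

(** Both groups act simply transitively on the H-class of [A], in compatible
    ways.

    A linear endomorphism of C(A) is determined by the images of the columns
    of [A], that is by [map_cols f], and every [F] with [F *m A = map_cols f]
    acts on C(A) as [f] does ([map_colsM]). An element of the Schuetzenberger
    group is determined by the image of [A], because every member of H_A is
    [A] times some matrix on the right ([schutz_ext]). So the theorem
    reduces to one statement ([Hclass_map_colsP]): the members of H_A are
    exactly the matrices [map_cols f] with [f] in Aut(C(A)). The map psi then
    matches [f] with the group element that sends [A] to [map_cols f], and
    multiplicativity comes down to the identity
    [F *m map_cols g = map_cols (f * g)].

    If [B] is H-related to [A], say [B = X *m A] and [A = W *m B], then
    multiplication by [X] and by [W] are inverse automorphisms of C(A); the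
    R-relation is what makes them map C(A) to itself. Conversely, [map_cols f]
    is R-related to [A] since its columns span C(A), but the L-relation
    requires [f] to be induced by a matrix. This is the point specific to the
    tropical semiring, and it is a form of its exactness: a row [b] is a left
    multiple of [A] as soon as [b *m x] depends only on [A *m x]
    ([row_factor]). Here is why. For each nonzero row [a] of [A], residuation gives
    the largest scalar [u] with [u *: a <= b], and this [u] is [b *m w] for a
    column [w] normalised so that [a *m w = 1] ([residual_row]); take [w = 0] when
    [a = 0]. With [W]
    the matrix of these columns, [A *m W *m A >= A] and [b *m W *m A <= b] for
    the natural order. The first inequality reads
    [A *m (W *m A + 1) = A *m (W *m A)], so the hypothesis on [b] turns it
    into [b *m W *m A >= b]. Hence [(b *m W) *m A = b]. *)

Section ColumnSpaceAutomorphisms.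
Set Implicit Arguments.
Unset Strict Implicit.
Unset Printing Implicit Defensive.
Import Order.TTheory GRing.Theory Num.Theory.
Local Open Scope classical_set_scope.
Local Open Scope ring_scope.

(** * Residuation over the tropical semiring *)

Section TropicalScalars.
Variable R : realType.
Local Notation T := (tropical R).
Implicit Types x y : T.

Lemma tropDD x : x + x = x.
Proof. by case: x => [a|] //; congr Some; rewrite maxxx. Qed.

Lemma tropD_total x y : (x + y == y) || (y + x == x).
Proof.
case: x y => [a|] [b|]; rewrite ?eqxx ?orbT //.
have [/max_r e|/max_r e] := orP (le_total a b); apply/orP; [left|right];
  by apply/eqP; congr Some.
Qed.

Definition trop_inv x : T := if x is Some a then Some (- a) else None.

Lemma trop_mulV x : x != 0 -> x * trop_inv x = 1.
Proof. by case: x => [a|] // _; congr Some; rewrite subrr. Qed.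

(** The inequalities are for the natural order, [x <= y] meaning [x + y = y].
    For [a != 0], a minimum over a nonempty finite set is attained: the
    largest [u] with [u *: a <= b] is the least ratio [b_j / a_j] with [a_j]
    finite, and [w] is the unit vector at a minimising [j], divided by [a_j]. Producing [w] rather
    than [u] lets a kernel condition on [b] be applied to it. *)
Lemma residual_row m (a b : 'rV[T]_m) : exists w : 'cV[T]_m,
  a *m w *m a + a = a *m w *m a /\ b *m w *m a + b = b.
Proof.
have [j0 aj0|a0] := pickP (fun j => a 0 j != 0); last first.
  have -> : a = 0 by apply/rowP => j; have /negbFE/eqP -> := a0 j; rewrite mxE.
  by exists 0; rewrite !mulmx0 !addr0 add0r.
(* If [b 0 j] is -oo somewhere on the support of [a], it is a minimum of [F]. *)
pose F j := b 0 j * trop_inv (a 0 j).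
have [|x y z /eqP yx /eqP xz||//|j aj jmin] := @extremumP _ _
    (fun x y => x + y == y) j0 (fun j => a 0 j != 0) F.
- by move=> x /=; rewrite tropDD.
- by rewrite -xz addrA yx.
- exact: tropD_total.
exists (trop_inv (a 0 j) *: delta_mx j 0).
have wE (c : 'rV[T]_m) k :
    (c *m (trop_inv (a 0 j) *: delta_mx j 0 : 'cV_m) *m a) 0 k
      = c 0 j * trop_inv (a 0 j) * a 0 k.
  rewrite !mxE big_ord1 !mxE (bigD1 j) //= big1 ?addr0 => [|i /negbTE ij].
    by rewrite !mxE !eqxx mulr1.
  by rewrite !mxE ij !mulr0.
split; apply/rowP => k; rewrite mxE !wE.
  by rewrite trop_mulV // mul1r tropDD.
have [->|ak] := eqVneq (a 0 k) 0; first by rewrite mulr0 add0r.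
have /eqP := jmin k ak; rewrite /F => /(congr1 ( *%R^~ (a 0 k))).
by rewrite mulrDl -(mulrA (b 0 k)) (mulrC (trop_inv _)) trop_mulV // mulr1.
Qed.

End TropicalScalars.

(** * Factoring a matrix through another on the left *)

Section Matrices.
Variable R : realType.
Local Notation T := (tropical R).

(** Exactness of the tropical semiring: over a field this is the duality
    between row space and kernel, but without subtraction the kernel is
    replaced by the congruence [A *m x = A *m y]. The witness [b *m W] collects
    the residuals of [b] by the rows of [A]. *)
Lemma row_factor n m (A : 'M[T]_(n, m)) (b : 'rV[T]_m) :
  (forall x y : 'cV_m, A *m x = A *m y -> b *m x = b *m y) ->
  exists u, u *m A = b.
Proof.
move=> kerAb; have [w wP] := fin_all_exists (fun k => residual_row (row k A) b).
pose W := \matrix_(i, k) w k i 0.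
have mulWA (c : 'rV_m) : c *m W *m A = \sum_k c *m w k *m row k A.
  rewrite mulmx_sum_row; apply: eq_bigr => k _; apply/rowP => j.
  rewrite [RHS]mxE big_ord1 !mxE; congr (_ * _).
  by apply: eq_bigr => i _; rewrite mxE.
have bWA : b *m W *m A + b = b.
  rewrite mulWA; apply: (big_ind (fun z => z + b = b)).
  - by rewrite add0r.
  - by move=> x y xb yb; rewrite -addrA yb.
  - by move=> k _; have [] := wP k.
have AWA : A *m (W *m A + 1%:M) = A *m (W *m A).
  apply/row_matrixP => k; rewrite mulmxDr mulmx1 linearD /= !row_mul mulmxA.
  (* The [k]-th term of the sum already dominates row [k] of [A]. *)
  rewrite mulWA (bigD1 k) //= addrAC; congr (_ + _).
  by have [] := wP k.
exists (b *m W); rewrite -[RHS]bWA -mulmxA.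
suff : b *m (W *m A + 1%:M) = b *m (W *m A) by rewrite mulmxDr mulmx1 => ->.
apply/rowP => j.
have /kerAb/matrixP/(_ 0 0) :
    A *m col j (W *m A + 1%:M) = A *m col j (W *m A).
  by rewrite !colE [LHS]mulmxA AWA -mulmxA.
by rewrite !colE !(mulmxA b) -!colE [LHS]mxE [RHS]mxE.
Qed.

Lemma matrix_factor n m p (A : 'M[T]_(n, m)) (B : 'M[T]_(p, m)) :
  (forall x y : 'cV_m, A *m x = A *m y -> B *m x = B *m y) ->
  exists F, F *m A = B.
Proof.
move=> kerAB.
have [i|u uA] := fin_all_exists (fun i => @row_factor _ _ A (row i B) _).
  by move=> x y /kerAB e; rewrite -!row_mul e.
exists (\matrix_i u i); apply/row_matrixP => i.
by rewrite row_mul rowK uA.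
Qed.

(** * Automorphisms of a column space as matrices *)

Section ColumnSpaceMaps.
Variables (n m : nat) (A : 'M[T]_(n, m)).
Local Notation V := (colspace A).
Implicit Types (f g : semimod_aut V) (x : V).

Lemma col_span_mulP (v : 'cV_n) :
  reflect (exists c : 'cV_m, v = A *m c) (v \in col_span A).
Proof.
have mulE (c : 'cV_m) : A *m c = \sum_j c j 0 *: col j A.
  apply/colP => i; rewrite mxE summxE; apply: eq_bigr => j _.
  by rewrite !mxE mulrC.
apply: (iffP (col_spanP A v)) => [[c ->]|[c ->]].
  exists (\col_j c j); rewrite mulE.
  by apply: eq_bigr => j _; rewrite mxE.
by exists (c^~ 0); rewrite mulE.
Qed.

Lemma colspace_coords x : exists c : 'cV_m, col_vec x = A *m c.
Proof. exact/col_span_mulP/col_vecP. Qed.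

(** The coordinates [c] of [x] on the columns of [A] are not unique; the right
    hand side is nevertheless the same for all of them. This is the kernel
    condition under which [f] extends to a matrix. *)
Lemma map_cols_mul (f : {linear V -> V}) x (c : 'cV_m) :
  col_vec x = A *m c -> col_vec (f x) = map_cols f *m c.
Proof.
move=> xc; have -> : x = \sum_j c j 0 *: col_gen A j.
  apply: val_inj; rewrite raddf_sum /= xc; apply/colP => i.
  rewrite mxE summxE; apply: eq_bigr => j _.
  by rewrite !mxE mulrC.
rewrite linear_sum -[col_vec _]/(val _) raddf_sum; apply/colP => i.
rewrite summxE mxE; apply: eq_bigr => j _.
by rewrite linearZ !mxE mulrC.
Qed.

Lemma map_cols_extend f : exists F, F *m A = map_cols f.
Proof.
apply: matrix_factor => c d Acd.
have Ac : A *m c \in col_span A by apply/col_span_mulP; exists c.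
by rewrite -!(@map_cols_mul f (ColSpace Ac)).
Qed.

Lemma map_colsM (F : 'M_n) f x :
  F *m A = map_cols f -> F *m col_vec x = col_vec (f x).
Proof.
move=> FA; have [c xc] := colspace_coords x.
by rewrite (map_cols_mul f xc) xc mulmxA FA.
Qed.

Lemma col_map_cols f j : col j (map_cols f) = col_vec (f (col_gen A j)).
Proof. by apply/colP => i; rewrite !mxE. Qed.

Lemma mul_map_cols (F : 'M_n) f g :
  F *m A = map_cols f -> F *m map_cols g = map_cols (f * g)%g.
Proof.
move=> FA; apply/matrixP => i j.
rewrite [RHS]mxE /= -(map_colsM (g (col_gen A j)) FA) !mxE.
by apply: eq_bigr => k _; rewrite mxE.
Qed.

Lemma map_cols1 : map_cols (1%g : semimod_aut V) = A.
Proof. by apply/matrixP => i j; rewrite !mxE. Qed.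

Lemma map_cols_inj f g : map_cols f = map_cols g -> f = g.
Proof.
move=> fg; apply: semimod_autP => x; apply: val_inj => /=.
by have [c xc] := colspace_coords x; rewrite !(map_cols_mul _ xc) fg.
Qed.

Lemma map_cols_factor f : exists Y, map_cols f = A *m Y.
Proof.
have [j|Y YE] := fin_all_exists (fun j => _ : exists c : 'cV_m,
    col j (map_cols f) = A *m c).
  by rewrite col_map_cols; apply: colspace_coords.
exists (\matrix_(i, j) Y j i 0); apply/matrixP => i j.
have /colP/(_ i) := YE j; rewrite mxE => ->; rewrite !mxE.
by apply: eq_bigr => k _; rewrite mxE.
Qed.

Lemma mul_col_span (X : 'M_n) Y (v : 'cV_n) :
  X *m A = A *m Y -> v \in col_span A -> X *m v \in col_span A.
Proof.
move=> XA /col_span_mulP[c ->]; apply/col_span_mulP.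
by exists (Y *m c); rewrite !mulmxA XA.
Qed.

Lemma mul_span_fix (X : 'M_n) (v : 'cV_n) :
  X *m A = A -> v \in col_span A -> X *m v = v.
Proof. by move=> XA /col_span_mulP[c ->]; rewrite mulmxA XA. Qed.

(** The first two equations keep C(A) stable under [X] and [W], the last two
    make these mutually inverse on C(A), though in general not on the whole space. *)
Lemma map_cols_of_mul (X W : 'M_n) Y Z :
    X *m A = A *m Y -> W *m A = A *m Z ->
    W *m X *m A = A -> X *m W *m A = A ->
  exists f, X *m A = map_cols f.
Proof.
move=> XA WA WXA XWA.
pose g x := ColSpace (mul_col_span XA (col_vecP x)).
pose h x := ColSpace (mul_col_span WA (col_vecP x)).
have gL : semilinear g.
  split=> [a x|x y]; apply: val_inj => /=.
    by rewrite linearZ.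
  by rewrite linearD.
pose G : {linear V -> V} :=
  HB.pack g (GRing.isSemilinear.Build _ _ _ _ g gL).
have gK : cancel G h.
  by move=> x; apply: val_inj; rewrite /= mulmxA (mul_span_fix WXA) ?col_vecP.
have hK : cancel h G.
  by move=> x; apply: val_inj; rewrite /= mulmxA (mul_span_fix XWA) ?col_vecP.
exists (SemimodAut (Bijective gK hK)); apply/matrixP => i j.
by rewrite !mxE; apply: eq_bigr => k _; rewrite mxE.
Qed.

End ColumnSpaceMaps.
End Matrices.

(** * The H-class of a matrix and its Schuetzenberger group *)

Section GreenMatrices.
Variable R : realType.
Local Notation T := (tropical R).

(** Projecting an equality of [TMat]s gives an equality of dependent pairs;
    [conform_mx] recovers the matrices without a cast. *)
Lemma TMat_inj n m : injective (@TMat R n m).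
Proof.
move=> A B /(congr1 (fun a => conform_mx (0 : 'M_(n.+1, m.+1)) (tmat_mx a))).
by rewrite !conform_mx_id.
Qed.

Lemma tmul_TMatr (x c : tmat R) n m (A : 'M_(n.+1, m.+1)) :
  tmul x (TMat A) = Some c ->
  exists p (X : 'M_(p.+1, n.+1)), x = TMat X /\ c = TMat (X *m A).
Proof.
case: x => p q X; rewrite /tmul /=; case: eqP => //= e; subst q.
by rewrite conform_mx_id => -[<-]; exists p, X.
Qed.

Lemma tmul_TMatl (x c : tmat R) n m (A : 'M_(n.+1, m.+1)) :
  tmul (TMat A) x = Some c ->
  exists q (Y : 'M_(m.+1, q.+1)), x = TMat Y /\ c = TMat (A *m Y).
Proof.
case: x => p q Y; rewrite /tmul /=; case: eqP => //= e; subst p.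
by rewrite conform_mx_id => -[<-]; exists q, Y.
Qed.

(** Left translations commute with right ones, and H_a lies in the right
    ideal of [a]: the group acts freely. *)
Lemma schutz_ext (a : tmat R) (f g : schutzenberger a) :
  f (Hself a) = g (Hself a) -> f = g.
Proof.
have [s [hs fE]] := schutzP f; have [t [ht gE]] := schutzP g.
rewrite fE gE => /(congr1 sval) sa_ta; apply: schutz_eqP => h.
rewrite fE gE; apply: sval_Htype_inj.
have [x ax] := Htype_right h (Hclass_refl a).
have [sa] := tmulSome_A ax (phiE hs h).
have [ta] := tmulSome_A ax (phiE ht h).
rewrite (phiE hs (Hself a)) (phiE ht (Hself a)) sa_ta.
by move=> /Some_inj <- tax /Some_inj <-; rewrite tax => /Some_inj.
Qed.

(** Green's lemma for H-classes: as [b] is L-related to [a], some [t] satisfies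
    [t b = a]. For [h = a x] in H_a, this [t] undoes left multiplication by
    [s], which keeps [s h] in the L-class; being a left congruence, R is
    preserved as well. *)
Lemma stabilizes_mul (a s b : tmat R) :
  tmul s a = Some b -> Hclass a b -> stabilizes a s.
Proof.
move=> sa Hb h Hh; have [Rab Lab] := Hb; have [Rah Lah] := Hh.
have [t tb] : left_ideal b a by rewrite -Lab; apply: left_ideal_self.
have [x ax] := Htype_right (exist _ h Hh) (Hclass_refl a).
have := tmulA t b x; rewrite tb /= ax.
case bx: (tmul b x) => [c|] //= /esym tc.
have sh : tmul s h = Some c by have := tmulA s a x; rewrite sa ax /= bx.
exists c => //; split.
  rewrite /greenR Rab.
  exact: (greenR_mul Rah sa sh).
rewrite /greenL Lah.
by apply/seteqP; split; apply: left_ideal_sub; [exists t | exists s].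
Qed.

Section Matrix.
Variables (n m : nat) (A : 'M[T]_(n.+1, m.+1)).
Implicit Types f g : semimod_aut (colspace A).

(** This identifies Aut(C(A)) with H_A as a set, and so provides both
    surjectivity of psi and the stability condition in its definition. *)
Lemma Hclass_map_colsP (b : tmat R) :
  Hclass (TMat A) b <-> exists f, b = TMat (map_cols f).
Proof.
split=> [[Rab Lab]|[f ->]].
  have [x /tmul_TMatr[p [X [_ bX]]]] : left_ideal (TMat A) b.
    by rewrite Lab; apply: left_ideal_self.
  have [y /tmul_TMatl[q [Y [_ bY]]]] : right_ideal (TMat A) b.
    by rewrite Rab; apply: right_ideal_self.
  have pn : p = n by move: bY; rewrite bX => /(congr1 (@nrow _)).
  subst p b; have qm : q = m by move: bY => /(congr1 (@ncol _)).
  subst q; move/TMat_inj in bY.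
  have [w /tmul_TMatr[p [W [_ AW]]]] : left_ideal (TMat (X *m A)) (TMat A).
    by rewrite -Lab; apply: left_ideal_self.
  have [z /tmul_TMatl[q [Z [_ AZ]]]] : right_ideal (TMat (X *m A)) (TMat A).
    by rewrite -Rab; apply: right_ideal_self.
  have pn : n = p by move: AW => /(congr1 (@nrow _)).
  have qm : m = q by move: AZ => /(congr1 (@ncol _)).
  subst p q; move/TMat_inj in AW; move/TMat_inj in AZ.
  have WA : W *m A = A *m Z by rewrite {1}AZ mulmxA -AW.
  have [||f ->] := map_cols_of_mul bY WA; last by exists f.
    by rewrite -mulmxA -AW.
  by rewrite -mulmxA WA mulmxA -AZ.
have [F FA] := map_cols_extend f; have [G GA] := map_cols_extend f^-1%g.
have [Y fY] := map_cols_factor f; have [Z fVZ] := map_cols_factor f^-1%g.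
have GF : G *m map_cols f = A by rewrite (mul_map_cols _ GA) mulVg map_cols1.
have FG : map_cols f *m Z = A.
  by rewrite -FA -mulmxA -fVZ (mul_map_cols _ FA) mulgV map_cols1.
split; apply/seteqP; split.
- by apply: right_ideal_sub; exists (TMat Z); rewrite tmulE FG.
- by apply: right_ideal_sub; exists (TMat Y); rewrite tmulE fY.
- by apply: left_ideal_sub; exists (TMat G); rewrite tmulE GF.
- by apply: left_ideal_sub; exists (TMat F); rewrite tmulE FA.
Qed.

Lemma stabilizes_map_cols (F : 'M_n.+1) f :
  F *m A = map_cols f -> stabilizes (TMat A) (TMat F).
Proof.
move=> FA; apply: (@stabilizes_mul _ _ (TMat (map_cols f))).
  by rewrite tmulE FA.
by apply/Hclass_map_colsP; exists f.
Qed.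

Lemma phi_Hself (F : 'M_n.+1) (hF : stabilizes (TMat A) (TMat F)) :
  sval (phi hF (Hself (TMat A))) = TMat (F *m A).
Proof. by apply: tmul_phi; rewrite tmulE. Qed.

Lemma schutz_map_cols f : exists gamma : schutzenberger (TMat A),
  sval (gamma (Hself (TMat A))) = TMat (map_cols f).
Proof.
have [F FA] := map_cols_extend f.
by exists (phiG (stabilizes_map_cols FA)); rewrite -FA; apply: phi_Hself.
Qed.

End Matrix.
End GreenMatrices.
End ColumnSpaceAutomorphisms.

Theorem theorem3p4 (R : realType) (n m : nat)
    (A : 'M[tropical R]_(n.+1, m.+1)) :
  (forall f : semimod_aut (colspace A),
     exists (F : 'M[tropical R]_n.+1) (hF : stabilizes (TMat A) (TMat F)),
       sval (phi hF (Hself (TMat A))) = TMat (map_cols f))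
  /\
  (exists (psi : {multiplicative semimod_aut (colspace A)
                                 -> schutzenberger (TMat A)})
          (varphi : schutzenberger (TMat A) -> semimod_aut (colspace A)),
     [/\ (forall (f : semimod_aut (colspace A)) (F : 'M[tropical R]_n.+1)
                 (hF : stabilizes (TMat A) (TMat F)),
            sval (phi hF (Hself (TMat A))) = TMat (map_cols f) ->
            psi f = phiG hF),
         (forall (X : tmat R) (hX : stabilizes (TMat A) X) (x : colspace A),
            tmul X (TMat x) = Some (TMat (varphi (phiG hX) x))),
         cancel psi varphi
       & cancel varphi psi]).
Proof.
have part1 (f : semimod_aut (colspace A)) :
    exists (F : 'M_n.+1) (hF : stabilizes (TMat A) (TMat F)),
      sval (phi hF (Hself (TMat A))) = TMat (map_cols f).
  have [F FA] := map_cols_extend f.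
  by exists F, (stabilizes_map_cols FA); rewrite phi_Hself FA.
split=> //.
have [psi psiE] := choice (@schutz_map_cols R n m A).
have psi_phiG (f : semimod_aut _) (F : 'M_n.+1) (hF : stabilizes (TMat A) (TMat F)) :
    sval (phi hF (Hself (TMat A))) = TMat (map_cols f) -> psi f = phiG hF.
  by move=> hE; apply: schutz_ext; apply: sval_Htype_inj; rewrite psiE -hE.
have psiM : {morph psi : f g / (f * g)%g}.
  move=> f g; apply: schutz_ext; apply: sval_Htype_inj; rewrite psiE.
  have [F [hF hE]] := part1 f; rewrite (psi_phiG _ _ _ hE) /= psiE tmulE /=.
  by move: hE; rewrite phi_Hself => /TMat_inj /mul_map_cols ->.
have /choice[varphi varphiE] (gamma : schutzenberger (TMat A)) :
    exists f : semimod_aut (colspace A),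
      sval (gamma (Hself (TMat A))) = TMat (map_cols f).
  exact/Hclass_map_colsP/svalP.
pose psi_mult := isMultiplicative.Build _ _ psi psiM.
pose Psi : {multiplicative _ -> _} := HB.pack psi psi_mult.
exists Psi, varphi; split=> //.
- move=> X hX x; have := varphiE (phiG hX); move: (varphi _) => f XA.
  (* Sizes first: [X] is square because [X] times [A] has as many rows as [A]. *)
  have [p [F [XE]]] := tmul_TMatr (phiE hX (Hself (TMat A))).
  rewrite [sval _]XA => FA; have pn : n = p by move: FA => /(congr1 (@nrow _)).
  subst p; move/TMat_inj/esym in FA.
  by rewrite XE tmulE (map_colsM x FA).
- by move=> f; apply/map_cols_inj/TMat_inj; rewrite -varphiE psiE.
- by move=> gamma; apply: schutz_ext; apply: sval_Htype_inj; rewrite psiE.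
Qed.
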